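(* Let $n\in\mathbb N$, $\beta\ge0$, $\delta\in(0,\frac12)$, $\mathcal X=\{-n,\dots,n\}$, $\mathcal H_\delta(x)=-|x+\delta|$, and let $P_{\beta,\delta}$ be the Metropolis–Hastings kernel with nearest-neighbour simple random walk proposal and target $\pi_{\beta,\delta}(x)\propto e^{-\beta\mathcal H_\delta(x)}$. Let $G=\{e,g\}$ with $gx=-x$, and let $L_{\beta,\delta}=\frac12\big(I+((P_{\beta,\delta})_{la})_{ra}\big)$, where $((P_{\beta,\delta})_{la})_{ra}$ is the state-dependent independent-double-average. For $\varepsilon>0$, $$t_{\mathrm{mix},1}(L_{\beta,\delta},\varepsilon)\le\frac{72n^3e^{2\beta\delta}}{1-e^{-\beta}}\Big(\beta n+\log\Big(\frac{2n+1}{\varepsilon}\Big)\Big),$$ $$t_{\mathrm{mix},1}(P_{\beta,\delta},\varepsilon)\ge\Big(\frac{e^{\beta(n-2\delta)}}{(2n+1)^2}-1\Big)\log\Big(\frac1\varepsilon\Big).$$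
   Context: The proposal $P_0$ has $P_0(n,n)=P_0(-n,-n)=1/2$ and $P_0(x,x+1)=P_0(x+1,x)=1/2$ for $-n\le x\le n-1$. With $h_+=\max\{h,0\}$, for $-n\le x\le n-1$: $P_{\beta,\delta}(x,x+1)=\frac12e^{-\beta(\mathcal H_\delta(x+1)-\mathcal H_\delta(x))_+}$, $P_{\beta,\delta}(x+1,x)=\frac12e^{-\beta(\mathcal H_\delta(x)-\mathcal H_\delta(x+1))_+}$, other off-diagonal entries are $0$, and diagonal entries make the rows sum to one. State-dependent averaging: writing $\pi=\pi_{\beta,\delta}$, let $Q$ be the Markov kernel $Q[f](x)=\frac{\pi(x)f(x)+\pi(-x)f(-x)}{\pi(x)+\pi(-x)}$; then $((P_{\beta,\delta})_{la})_{ra}=QP_{\beta,\delta}Q$, i.e. its $(x,y)$ entry is $\sum_{a,b\in\{1,-1\}}\frac{\pi(ax)\,\pi(y)}{(\pi(x)+\pi(-x))(\pi(y)+\pi(-y))}P_{\beta,\delta}(ax,by)$. For a $\pi$-stationary kernel $P$, $d_1(P,t)=\max_x\sum_y|P^t(x,y)-\pi(y)|$ and $t_{\mathrm{mix},1}(P,\varepsilon)=\inf\{t\in\mathbb N:d_1(P,t)\le\varepsilon\}$, with $\mathbb N=\{1,2,\dots\}$. For $\beta=0$ the first upper bound is read as $+\infty$.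
   Formalization: ''ε>0'' is restricted to 0<ε≤2: as d_1≤2 always, larger ε gives t_mix,1=1 trivially, and both stated bounds fail for large ε (e.g. ε=e^10, n=1, with β=1 for the upper bound and β=0 for the lower bound). *)

(* Defs.v *)
From HB Require Import structures.
From mathcomp Require Import all_boot all_order all_algebra.
From mathcomp Require Import all_classical all_reals all_analysis.

Set Implicit Arguments.
Unset Strict Implicit.
Unset Printing Implicit Defensive.

Import Order.TTheory GRing.Theory Num.Theory.
Local Open Scope classical_set_scope.
Local Open Scope ring_scope.

Section MixingTime.
Context {R : realType} {m : nat}.
Implicit Types (pi : 'I_m.+1 -> R) (P : 'M[R]_m.+1).

(* The l^1 distance, i.e. twice the total variation distance.  The sums are
   nonnegative, so the default value 0 of the big max is harmless. *)
Definition d1 pi P (t : nat) : R :=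
  \big[Num.max/0]_x \sum_y `|(P ^+ t) x y - pi y|.

(* The infimum over t = 1, 2, ...; it is +oo if the level eps is never
   reached. *)
Definition tmix1 pi P (eps : R) : \bar R :=
  ereal_inf [set t%:R%:E | t in [set t : nat | (0 < t)%N /\ d1 pi P t <= eps]].

End MixingTime.

(* The state space {-n, ..., n}; the ordinal i stands for the integer i - n. *)
Notation state n := 'I_(n.*2.+1).

Definition coord {n : nat} (x : state n) : int := x%:Z - n%:Z.

(* The action x |-> - x of the nontrivial element g of G = {e, g}. *)
Definition flip {n : nat} (x : state n) : state n := rev_ord x.

Lemma coord_flip (n : nat) (x : state n) : coord (flip x) = - coord x.
Proof.
have le_x : (x <= n.*2)%N by rewrite -ltnS.
have flipE : (flip x : nat) = (n.*2 - x)%N by rewrite /flip /= subSS.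
rewrite /coord flipE -subzn//; move: (x : nat) {le_x flipE} => k.
by rewrite -addnn PoszD opprB addrAC addrK.
Qed.

Section Chain.
Context {R : realType} {n : nat}.
Implicit Types (pi : state n -> R) (P : 'M[R]_(n.*2.+1)).

Definition energy (delta : R) (x : state n) : R := - `|(coord x)%:~R + delta|.

Definition gibbs (beta delta : R) (x : state n) : R :=
  expR (- beta * energy delta x) / \sum_y expR (- beta * energy delta y).

(* Nearest-neighbour simple random walk, holding at the end points n and -n. *)
Definition proposal : 'M[R]_(n.*2.+1) :=
  \matrix_(x, y)
    if (`|coord x - coord y| == 1) || ((x == y) && (`|coord x| == n%:Z))
    then 2^-1 else 0.

(* The off-diagonal entries of the Metropolis-Hastings kernel; the proposal
   being symmetric, the acceptance probability is min(1, pi(y) / pi(x)). *)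
Definition mh_move (beta delta : R) (x y : state n) : R :=
  proposal x y *
    expR (- beta * Num.max (energy delta y - energy delta x) 0).

Definition mh_kernel (beta delta : R) : 'M[R]_(n.*2.+1) :=
  \matrix_(x, y)
    if x == y then 1 - \sum_(z | z != x) mh_move beta delta x z
    else mh_move beta delta x y.

(* At the fixed point x = flip x the two terms add up to give Q x x = 1. *)
Definition orbit_kernel pi : 'M[R]_(n.*2.+1) :=
  \matrix_(x, y)
    ((pi x * (y == x)%:R + pi (flip x) * (y == flip x)%:R)
       / (pi x + pi (flip x))).

Lemma orbit_kernelE pi (f : 'cV[R]_(n.*2.+1)) (x : state n) :
  (orbit_kernel pi *m f) x 0 =
    (pi x * f x 0 + pi (flip x) * f (flip x) 0) / (pi x + pi (flip x)).
Proof.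
rewrite mxE.
under eq_bigr do rewrite mxE mulrAC mulrDl -!mulrA.
rewrite -mulr_suml big_split /= -!mulr_sumr; congr ((_ * _ + _ * _) / _).
  by rewrite (bigD1 x)//= eqxx mul1r big1 ?addr0// => z /negPf->; rewrite mul0r.
rewrite (bigD1 (flip x))//= eqxx mul1r big1 ?addr0// => z /negPf->.
by rewrite mul0r.
Qed.

(* The state-dependent independent-double-average (P_la)_ra = Q P Q. *)
Definition double_average pi P : 'M[R]_(n.*2.+1) :=
  orbit_kernel pi *m P *m orbit_kernel pi.

Definition lazy_average (beta delta : R) : 'M[R]_(n.*2.+1) :=
  2^-1 *: (1%:M +
    double_average (gibbs beta delta) (mh_kernel beta delta)).

End Chain.

(* Main.v *)
Require Import Defs.
From HB Require Import structures.
From mathcomp Require Import all_boot all_order all_algebra.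
From mathcomp Require Import all_classical all_reals all_analysis.
From mathcomp Require Import ring lra zify.

Import Order.TTheory GRing.Theory Num.Theory.
Local Open Scope classical_set_scope.
Local Open Scope ring_scope.

(** Everything is done in the l^2 space weighted by the Gibbs measure [pi], where
    a reversible kernel is self-adjoint; [ip] is its inner product. Eigenvectors
    are replaced by quadratic forms.

    Upper bound. The averaging kernel [Q] is the orthogonal projection onto even
    functions, so the Rayleigh quotient of [Q P Q] at [f] only involves the even
    function [Q f]. The chain [P] is slow because it has to cross the valley of
    [pi] at the origin, but even functions do not see this: they live on
    [{0, ..., n}], where [pi] is increasing, and the path from any state to [n]
    only goes uphill. The resulting Poincare inequality, [poincare_even], has the
    constant [12 n^2], uniformly in [beta] and [delta]. For the lazy kernel this
    gives, in [lazy_norm_decay], an exponential decay of the norm of mean zero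
    functions, and [lazy_average_l1_le] turns it into the decay of the l^1
    distance. The stated bound, which is larger by factors [n],
    [expR (2 beta delta)] and [1 / (1 - expR (- beta))], follows with room for the
    integer part.

    Lower bound. The centred indicator of the negative half line has a Rayleigh
    quotient very close to one for [P], since the only edge that it detects sits at
    the bottom of the valley ([rayleigh_mh_ge]). By log-convexity of the norms
    [|P^s f|], a function of Rayleigh quotient [lam] cannot decay faster than
    [lam^s], whereas a distance at most [eps] at time [t] forces decay by [eps]
    every [t] steps. Hence [lam^t <= eps] ([rayleigh_exp_le]), and taking logarithms
    gives the claim. *)

(** * Elementary inequalities *)

(** Lagrange's identity writes twice the defect as a sum of squares. *)
Lemma cauchy_schwarz (R : realFieldType) (I : finType) (w f g : I -> R) :
  (forall i, 0 <= w i) ->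
  (\sum_i w i * f i * g i) ^+ 2 <=
    (\sum_i w i * f i ^+ 2) * (\sum_i w i * g i ^+ 2).
Proof.
move=> w_ge0; set C := (X in X ^+ 2); set A := (X in _ <= X * _).
set B := (X in _ <= _ * X).
have dAB : A * B = \sum_i \sum_j (w i * f i ^+ 2) * (w j * g j ^+ 2).
  by rewrite /A /B big_distrlr.
have dBA : A * B = \sum_i \sum_j (w j * f j ^+ 2) * (w i * g i ^+ 2).
  by rewrite dAB exchange_big.
have dCC : C ^+ 2 = \sum_i \sum_j (w i * f i * g i) * (w j * f j * g j).
  by rewrite expr2 /C big_distrlr.
have lagrange : A * B + A * B - 2 * C ^+ 2 =
    \sum_i \sum_j w i * w j * (f i * g j - f j * g i) ^+ 2.
  rewrite {1}dAB dBA dCC mulr_sumr -sumrN -!big_split /=.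
  apply: eq_bigr => i _; rewrite mulr_sumr -sumrN -!big_split /=.
  by apply: eq_bigr => j _; ring.
have : 0 <= \sum_i \sum_j w i * w j * (f i * g j - f j * g i) ^+ 2.
  by do 2![apply: sumr_ge0 => ? _]; rewrite mulr_ge0 ?sqr_ge0// mulr_ge0.
rewrite -lagrange; lra.
Qed.

Lemma geometric_bounded_le1 (R : realType) (r C : R) :
  0 <= r -> (forall k, r ^+ k <= C) -> r <= 1.
Proof.
move=> r0 hC; rewrite leNgt; apply/negP => r1.
have [k hk] : exists k : nat, C < 1 + (r - 1) *+ k.
  exists (Num.truncn (C / (r - 1))).+1.
  have r10 : 0 < r - 1 by rewrite subr_gt0.
  have := truncnS_gt (C / (r - 1)).
  by rewrite ltr_pdivrMr// -mulr_natl => ?; lra.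
have := hC k; rewrite leNgt => /negP; apply; apply: lt_le_trans hk _.
elim: k => [|k IH]; first by rewrite mulr0n addr0 expr0.
rewrite exprS mulrSr; have : 1 + (r - 1) *+ k >= 1 by rewrite lerDl mulrn_wge0// subr_ge0 ltW.
move: IH r1; set a := (r - 1) *+ k; set b := r ^+ k => IH r1 h.
nra.
Qed.

Lemma ln_le_sub1 (R : realType) (x : R) : 0 < x -> ln x <= x - 1.
Proof.
move=> x0; have := @le_ln1Dx R (x - 1); rewrite (addrC 1) subrK; apply; lra.
Qed.

(** * Reversible chains as self-adjoint operators *)

Section WeightedL2.
Context {R : realFieldType} {m : nat}.
Implicit Types (pi : 'I_m.+1 -> R) (P : 'M[R]_m.+1) (f g : 'cV[R]_m.+1).

Definition ip pi f g : R := \sum_x pi x * f x 0 * g x 0.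

Definition ones : 'cV[R]_m.+1 := const_mx 1.

Definition prob pi := (forall x, 0 <= pi x) /\ \sum_x pi x = 1.

Definition stochastic P := forall x, prob (P x).

Definition reversible pi P := forall x y, pi x * P x y = pi y * P y x.

Lemma ipC pi f g : ip pi f g = ip pi g f.
Proof. by apply: eq_bigr => x _; ring. Qed.

Lemma ipDr pi f g h : ip pi f (g + h) = ip pi f g + ip pi f h.
Proof. by rewrite -big_split; apply: eq_bigr => x _; rewrite !mxE /=; ring. Qed.

Lemma ipZr pi f a g : ip pi f (a *: g) = a * ip pi f g.
Proof. by rewrite mulr_sumr; apply: eq_bigr => x _; rewrite !mxE /=; ring. Qed.

Lemma ipDl pi f g h : ip pi (f + g) h = ip pi f h + ip pi g h.
Proof. by rewrite ipC ipDr !(ipC _ h). Qed.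

Lemma ipZl pi a f g : ip pi (a *: f) g = a * ip pi f g.
Proof. by rewrite ipC ipZr ipC. Qed.

Lemma ip11 pi : prob pi -> ip pi ones ones = 1.
Proof.
by move=> [_ <-]; apply: eq_bigr => x _; rewrite !mxE !mulr1.
Qed.

Lemma pointwise_le_norm pi f x : prob pi -> pi x * f x 0 ^+ 2 <= ip pi f f.
Proof.
move=> [pi_ge0 _]; rewrite /ip (bigD1 x)//= -mulrA expr2 lerDl.
by apply: sumr_ge0 => y _; rewrite -mulrA mulr_ge0// -expr2 sqr_ge0.
Qed.

Lemma norm_le_sup pi f M : prob pi -> (forall x, `|f x 0| <= M) -> ip pi f f <= M ^+ 2.
Proof.
move=> [pi_ge0 pi1] fM; rewrite -[leRHS]mul1r -pi1 mulr_suml.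
apply: ler_sum => x _; rewrite -mulrA ler_wpM2l// -expr2 -real_normK ?num_real//.
by rewrite ler_pXn2r ?nnegrE//; exact: le_trans (fM x).
Qed.

Lemma ip_cauchy_schwarz pi f g :
  prob pi -> ip pi f g ^+ 2 <= ip pi f f * ip pi g g.
Proof.
move=> [pi_ge0 _].
have := cauchy_schwarz _ _ (fun x => pi x) (fun x => f x 0) (fun x => g x 0) pi_ge0.
by congr (is_true (_ <= _ * _)); apply: eq_bigr => x _; ring.
Qed.

Lemma stochastic_ones P : stochastic P -> P *m ones = ones.
Proof.
move=> hP; apply/matrixP => x y; rewrite !mxE.
by under eq_bigr do rewrite mxE mulr1; case: (hP x).
Qed.

Lemma reversible_ip pi P f g :
  reversible pi P -> ip pi f (P *m g) = ip pi (P *m f) g.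
Proof.
move=> rev; transitivity (\sum_x \sum_y pi x * P x y * f x 0 * g y 0).
  apply: eq_bigr => x _; rewrite mxE mulr_sumr.
  by apply: eq_bigr => y _; ring.
rewrite exchange_big /=; apply: eq_bigr => y _.
rewrite mxE mulr_sumr mulr_suml; apply: eq_bigr => x _.
by rewrite rev; ring.
Qed.

Lemma stationary pi P f : stochastic P -> reversible pi P ->
  ip pi ones (P *m f) = ip pi ones f.
Proof. by move=> sP rP; rewrite reversible_ip// stochastic_ones. Qed.

(** Jensen's inequality for the rows of [P], followed by stationarity applied to
    the function [f ^+ 2]. *)
Lemma contraction pi P f : prob pi -> stochastic P -> reversible pi P ->
  ip pi (P *m f) (P *m f) <= ip pi f f.
Proof.
move=> ppi sP rP; pose f2 : 'cV[R]_m.+1 := \col_x (f x 0 ^+ 2).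
have <- : ip pi ones f2 = ip pi f f.
  by apply: eq_bigr => x _; rewrite !mxE; ring.
rewrite -(@stationary pi P f2)//; apply: ler_sum => x _.
rewrite [ones x 0]mxE mulr1 -mulrA ler_wpM2l//; first by case: ppi.
have := ip_cauchy_schwarz (P x) f ones (sP x).
rewrite ip11// mulr1; congr (is_true (_ <= _)).
  by rewrite !mxE -expr2; congr (_ ^+ 2); apply: eq_bigr => y _; rewrite mxE mulr1.
by rewrite mxE; apply: eq_bigr => y _; rewrite !mxE expr2 mulrA.
Qed.

(** The right-hand side is the Dirichlet form of [P]. It turns bounds on the
    spectral gap into estimates on individual edges. *)
Lemma dirichletE pi P f : stochastic P -> reversible pi P ->
  ip pi f f - ip pi f (P *m f) =
    2^-1 * \sum_x \sum_y pi x * P x y * (f x 0 - f y 0) ^+ 2.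
Proof.
move=> sP rP.
have d1 : ip pi f f = \sum_x \sum_y pi x * P x y * f x 0 ^+ 2.
  apply: eq_bigr => x _; rewrite -mulr_suml -mulr_sumr.
  by case: (sP x) => _ ->; ring.
have d2 : ip pi f f = \sum_x \sum_y pi x * P x y * f y 0 ^+ 2.
  rewrite d1 exchange_big; apply: eq_bigr => x _; apply: eq_bigr => y _ /=.
  by rewrite rP.
have d3 : ip pi f (P *m f) = \sum_x \sum_y pi x * P x y * f x 0 * f y 0.
  apply: eq_bigr => x _; rewrite mxE mulr_sumr.
  by apply: eq_bigr => y _; ring.
suff -> : \sum_x \sum_y pi x * P x y * (f x 0 - f y 0) ^+ 2 =
    ip pi f f + ip pi f f - 2 * ip pi f (P *m f) by field.
rewrite {1}d1 d2 d3 mulr_sumr -sumrN -!big_split /=.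
apply: eq_bigr => x _; rewrite mulr_sumr -sumrN -!big_split /=.
by apply: eq_bigr => y _; ring.
Qed.

Lemma expmxS P t f : P ^+ t.+1 *m f = P *m (P ^+ t *m f).
Proof. by rewrite exprS mulmxA. Qed.

Lemma stationary_exp pi P t f : stochastic P -> reversible pi P ->
  ip pi ones (P ^+ t *m f) = ip pi ones f.
Proof.
move=> sP rP; elim: t => [|t IH]; first by rewrite expr0 mul1mx.
by rewrite expmxS stationary.
Qed.

Lemma ip_centered pi f : prob pi ->
  ip pi (f - ip pi ones f *: ones) (f - ip pi ones f *: ones) =
    ip pi f f - ip pi ones f ^+ 2.
Proof.
move=> ppi; rewrite -scaleNr !(ipDl, ipDr, ipZl, ipZr) ip11// (ipC _ f ones).
ring.
Qed.

Lemma centered_mean0 pi f : prob pi ->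
  ip pi ones (f - ip pi ones f *: ones) = 0.
Proof. by move=> ppi; rewrite -scaleNr ipDr ipZr ip11//; ring. Qed.

(** The mean minimises the mean square deviation, so a Poincare inequality may
    be centred at any convenient constant. *)
Lemma variance_le pi f c : prob pi ->
  ip pi ones f = 0 -> ip pi f f <= ip pi (f - c *: ones) (f - c *: ones).
Proof.
move=> ppi f0; rewrite -scaleNr !(ipDl, ipDr, ipZl, ipZr) ip11// (ipC _ f ones) f0.
have := sqr_ge0 c; rewrite expr2; lra.
Qed.

Lemma stochasticM P P' : stochastic P -> stochastic P' -> stochastic (P *m P').
Proof.
move=> sP sP' x; split=> [y|].
  rewrite mxE sumr_ge0// => z _; rewrite mulr_ge0//.
    by case: (sP x).
  by case: (sP' z).
under eq_bigr do rewrite mxE; rewrite exchange_big /=.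
under eq_bigr => z _ do rewrite -mulr_sumr (sP' z).2 mulr1.
exact: (sP x).2.
Qed.

(** Detailed balance as a matrix identity, the form in which it passes to
    products. *)
Lemma reversibleP pi P : reversible pi P <->
  diag_mx (\row_x pi x) *m P = P^T *m diag_mx (\row_x pi x).
Proof.
rewrite mul_diag_mx mul_mx_diag; split=> [rP | /matrixP rP x y].
  by apply/matrixP => x y; rewrite !mxE rP mulrC.
by have := rP x y; rewrite !mxE mulrC [X in _ = X]mulrC mulrC.
Qed.

Lemma reversible_sandwich pi P P' : reversible pi P -> reversible pi P' ->
  reversible pi (P *m P' *m P).
Proof.
move=> /reversibleP rP /reversibleP rP'; apply/reversibleP.
by rewrite !trmx_mul !mulmxA rP -!mulmxA -rP !mulmxA -[X in X *m P]mulmxA rP' mulmxA.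
Qed.

Definition lazy P : 'M[R]_m.+1 := 2^-1 *: (1%:M + P).

Lemma stochastic_lazy P : stochastic P -> stochastic (lazy P).
Proof.
move=> sP x; have [Px0 Px1] := sP x; split=> [y|].
  by rewrite !mxE mulr_ge0// addr_ge0// ler0n.
under eq_bigr do rewrite !mxE.
rewrite -mulr_sumr big_split /= Px1 (bigD1 x)//= eqxx mulr1n big1 ?addr0; first by field.
by move=> y /negPf; rewrite eq_sym => ->.
Qed.

Lemma reversible_lazy pi P : reversible pi P -> reversible pi (lazy P).
Proof.
move=> rP x y; rewrite !mxE (eq_sym y x).
have := rP x y; case: eqVneq => [->//|_] /=; rewrite mulr0n => h.
by rewrite !add0r mulrCA h mulrCA.
Qed.

(** Laziness removes the need to control the negative spectrum: in
    [(|g|^2 + 2 <g, P g> + |P g|^2) / 4] the last term is at most [|g|^2], so an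
    upper bound on the Rayleigh quotient of [P] is enough. *)
Lemma lazy_norm_decay pi P gam f t : prob pi -> stochastic P -> reversible pi P ->
  gam <= 1 ->
  (forall f, ip pi ones f = 0 -> ip pi f (P *m f) <= (1 - gam) * ip pi f f) ->
  ip pi ones f = 0 ->
  ip pi (lazy P ^+ t *m f) (lazy P ^+ t *m f) <=
    (1 - gam / 2) ^+ t * ip pi f f.
Proof.
move=> ppi sP rP gam1 gap f0; elim: t => [|t IH].
  by rewrite !expr0 mul1mx mul1r.
rewrite expmxS exprS -mulrA; set g := _ *m f in IH *.
have g0 : ip pi ones g = 0.
  rewrite stationary_exp//; [exact: stochastic_lazy | exact: reversible_lazy].
have h0 : 0 <= 1 - gam / 2 by lra.
apply: le_trans (ler_wpM2l h0 IH).
rewrite /lazy -scalemxAl mulmxDl mul1mx ipZl ipZr !(ipDl, ipDr) (ipC _ (P *m g) g).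
have := gap _ g0; have := contraction _ _ g ppi sP rP.
set a := ip _ _ _; set b := ip _ _ _; set c := ip _ _ _ => h1 h2; lra.
Qed.

(** Duality: a row of [P ^+ t - pi], tested against its own sign vector, gives
    its l^1 norm, and the sign vector has norm at most [1]. *)
Lemma l1_le_norm pi P t x (r : R) : prob pi -> stochastic P -> reversible pi P ->
  0 <= r ->
  (forall f, ip pi ones f = 0 ->
     ip pi (P ^+ t *m f) (P ^+ t *m f) <= r * ip pi f f) ->
  pi x * (\sum_y `|(P ^+ t) x y - pi y|) ^+ 2 <= r.
Proof.
move=> ppi sP rP r0 hr; pose s : 'cV[R]_m.+1 := \col_y Num.sg ((P ^+ t) x y - pi y).
pose f0 := s - ip pi ones s *: ones.
have -> : \sum_y `|(P ^+ t) x y - pi y| = (P ^+ t *m f0) x 0.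
  have Pt1 : P ^+ t *m ones = ones.
    elim: t {hr s f0} => [|t IH]; first by rewrite expr0 mul1mx.
    by rewrite expmxS IH stochastic_ones.
  rewrite mulmxBr -scalemxAr Pt1 !mxE mulr1 -sumrB; apply: eq_bigr => y _.
  by rewrite !mxE normrEsg mulr1; ring.
apply: le_trans (pointwise_le_norm _ _ _ ppi) _; apply: le_trans (hr _ _) _.
  exact: centered_mean0.
rewrite -[leRHS]mulr1 ler_wpM2l// ip_centered//.
have : ip pi s s <= 1 ^+ 2.
  by apply: norm_le_sup => // y; rewrite mxE normr_sg; case: (_ != 0); rewrite ?lexx ?ler01.
rewrite expr1n; have := sqr_ge0 (ip pi ones s); lra.
Qed.

(** Self-adjointness makes [s |-> |P^s f|] log-convex, so its successive ratios
    never fall below the first one, which is at least the Rayleigh quotient. This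
    replaces the expansion of [f] in eigenvectors. *)
Lemma norm_exp_ge pi P f lam s : prob pi -> stochastic P -> reversible pi P ->
  0 < lam -> 0 < ip pi f f -> lam * ip pi f f <= ip pi f (P *m f) ->
  lam ^+ 2 ^+ s * ip pi f f <= ip pi (P ^+ s *m f) (P ^+ s *m f).
Proof.
move=> ppi sP rP lam0 f0 hf; pose B s := ip pi (P ^+ s *m f) (P ^+ s *m f).
have B0 : B 0%N = ip pi f f by rewrite /B expr0 mul1mx.
have step i : 0 < B i /\ lam ^+ 2 * B i <= B i.+1.
  elim: i => [|i [Bi hi]].
    rewrite B0; split=> //.
    have := ip_cauchy_schwarz pi f (P *m f) ppi.
    rewrite /B expr1 => hcs.
    rewrite -(ler_pM2l f0); apply: le_trans hcs.
    have -> : ip pi f f * (lam ^+ 2 * ip pi f f) = (lam * ip pi f f) ^+ 2 by ring.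
    by rewrite ler_pXn2r ?nnegrE// ?(le_trans _ hf)// mulr_ge0// ltW.
  have Bi1 : 0 < B i.+1 by apply: lt_le_trans hi; rewrite mulr_gt0// exprn_gt0.
  split=> //.
  have : B i.+1 ^+ 2 <= B i * B i.+2.
    have -> : B i.+1 = ip pi (P ^+ i *m f) (P ^+ i.+2 *m f).
      by rewrite (expmxS P i.+1) reversible_ip// -expmxS.
    exact: ip_cauchy_schwarz.
  move=> h; rewrite -(ler_pM2l Bi); apply: le_trans h.
  by rewrite mulrA expr2 ler_pM2r// mulrC.
rewrite -B0; elim: s => [|s IH]; first by rewrite expr0 mul1r.
by apply: le_trans (step s).2; rewrite exprS -mulrA ler_wpM2l ?sqr_ge0.
Qed.

(** Mean zero functions are preserved by [P], so the l^1 bound at time [t] can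
    be iterated [k] times. *)
Lemma sup_decay pi P f t k eps M : prob pi -> stochastic P -> reversible pi P ->
  (forall x, \sum_y `|(P ^+ t) x y - pi y| <= eps) ->
  ip pi ones f = 0 -> (forall x, `|f x 0| <= M) ->
  forall x, `|(P ^+ (t * k) *m f) x 0| <= eps ^+ k * M.
Proof.
move=> ppi sP rP hd f0 fM; elim: k => [|k IH] x.
  by rewrite muln0 !expr0 mul1mx mul1r.
rewrite mulnS exprD -mulmxA; set g := _ *m f in IH *.
have g0 : ip pi ones g = 0 by rewrite stationary_exp.
have -> : (P ^+ t *m g) x 0 = \sum_y ((P ^+ t) x y - pi y) * g y 0.
  under eq_bigr do rewrite mulrBl.
  rewrite sumrB mxE; suff -> : \sum_y pi y * g y 0 = 0 by rewrite subr0.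
  by rewrite -[RHS]g0; apply: eq_bigr => y _; rewrite [ones y 0]mxE mulr1.
rewrite exprS -mulrA; apply: le_trans (ler_norm_sum _ _ _) _.
apply: le_trans (_ : \sum_y `|(P ^+ t) x y - pi y| * (eps ^+ k * M) <= _).
  by apply: ler_sum => y _; rewrite normrM ler_wpM2l.
rewrite -mulr_suml ler_wpM2r//; exact: le_trans (IH x).
Qed.

End WeightedL2.

(** Along the times [t * k], the norm of [P^(t k) f] is at least [lam^(t k) |f|]
    and at most a constant times [eps^k]. Letting [k] tend to infinity removes the
    constant that separates the two norms, so no eigenvector is needed to obtain
    the inequality without a loss. *)
Lemma rayleigh_exp_le (R : realType) (m : nat) (pi : 'I_m.+1 -> R) (P : 'M[R]_m.+1)
    (f : 'cV[R]_m.+1) (lam eps : R) (t : nat) :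
  prob pi -> stochastic P -> reversible pi P ->
  ip pi ones f = 0 -> 0 < ip pi f f -> 0 < lam -> 0 < eps ->
  lam * ip pi f f <= ip pi f (P *m f) ->
  (forall x, \sum_y `|(P ^+ t) x y - pi y| <= eps) -> lam ^+ t <= eps.
Proof.
move=> ppi sP rP f0 ff lam0 eps0 hf hd; pose M := \sum_x `|f x 0|.
have fM x : `|f x 0| <= M.
  by rewrite /M (bigD1 x)//= lerDl sumr_ge0.
have lt0 : 0 <= lam ^+ t / eps by rewrite divr_ge0 ?exprn_ge0 ?ltW.
suff : (lam ^+ t / eps) ^+ 2 <= 1.
  by rewrite expr_le1// ler_pdivrMr// mul1r.
apply: (@geometric_bounded_le1 _ _ (M ^+ 2 / ip pi f f)) => [|k].
  exact: sqr_ge0.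
have h1 := norm_exp_ge pi P f lam (t * k) ppi sP rP lam0 ff hf.
have h2 := norm_le_sup pi _ _ ppi (sup_decay pi P f t k eps M ppi sP rP hd f0 fM).
rewrite ler_pdivlMr// !expr_div_n (exprAC lam t) (exprAC eps 2) -(exprM _ t) mulrAC.
rewrite ler_pdivrMr ?exprn_gt0// [leRHS]mulrC -exprMn.
exact: le_trans h1 h2.
Qed.

(** * The Gibbs measure and the kernels on the segment *)

Section Model.
Context {R : realType} {n : nat}.
Implicit Types (x y : state n) (beta delta : R).

Lemma coordR x : (Defs.coord x)%:~R = x%:R - n%:R :> R.
Proof. by rewrite /Defs.coord rmorphB. Qed.

Lemma energy_ge delta x : 0 < delta -> (n <= x)%N ->
  energy delta x = - (x%:R - n%:R + delta).
Proof.
move=> d0 nx; rewrite /energy coordR ger0_norm//.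
by rewrite addr_ge0 ?subr_ge0 ?ler_nat// ltW.
Qed.

Lemma energy_lt delta x : delta < 2^-1 -> (x < n)%N ->
  energy delta x = x%:R - n%:R + delta.
Proof.
move=> d1 xn; rewrite /energy coordR ltr0_norm ?opprK//.
have : x%:R + 1 <= n%:R :> R by rewrite natr1 ler_nat.
lra.
Qed.

Lemma gibbs_weight_gt0 beta delta :
  0 < \sum_(y : state n) expR (- beta * energy delta y).
Proof.
rewrite (bigD1 ord0)//= ltr_pwDl ?expR_gt0//.
by apply: sumr_ge0 => y _; rewrite ltW ?expR_gt0.
Qed.

Lemma gibbs_gt0 beta delta x : 0 < gibbs beta delta x.
Proof. by rewrite divr_gt0 ?expR_gt0 ?gibbs_weight_gt0. Qed.

Lemma prob_gibbs beta delta : prob (@gibbs R n beta delta).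
Proof.
split=> [x|]; first by rewrite ltW ?gibbs_gt0.
by rewrite -mulr_suml divff// gt_eqF ?gibbs_weight_gt0.
Qed.

(** Normalising constants cancel in ratios, so all the estimates on [gibbs] are
    comparisons of two energies. *)
Lemma gibbs_le beta delta x y c :
  beta * (energy delta y - energy delta x) <= c ->
  gibbs beta delta x <= expR c * gibbs beta delta y.
Proof.
move=> h; rewrite /gibbs mulrA ler_pM2r ?invr_gt0 ?gibbs_weight_gt0//.
rewrite -expRD ler_expR; lra.
Qed.

Lemma proposalE x y : x != y ->
  @proposal R n x y = if (x == y.+1 :> nat) || (y == x.+1 :> nat) then 2^-1 else 0.
Proof.
move=> xy; rewrite mxE (negPf xy) /= orbF; congr (if _ then _ else _).
rewrite /Defs.coord; apply/idP/idP => h; lia.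
Qed.

Lemma mh_move_ge0 beta delta x y : 0 <= mh_move beta delta x y.
Proof.
by rewrite mulr_ge0 ?expR_ge0// mxE; case: ifP; rewrite // invr_ge0.
Qed.

Lemma mh_move_le beta delta x y : 0 <= beta -> mh_move beta delta x y <= proposal x y.
Proof.
move=> b0; rewrite /mh_move ler_piMr//.
  by rewrite mxE; case: ifP; rewrite // invr_ge0.
rewrite -[leRHS]expR0 ler_expR mulNr oppr_le0 mulr_ge0//.
by rewrite le_max lexx orbT.
Qed.

Lemma sum_ord_eq_le1 (N k : nat) : \sum_(z < N) (z == k :> nat)%:R <= 1 :> R.
Proof.
have [kN|Nk] := ltnP k N.
  rewrite (bigD1 (Ordinal kN))//= eqxx big1 ?addr0// => z.
  by rewrite -val_eqE /= => /negPf ->.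
rewrite big1// => z _; case: eqP => // zk.
by move: (ltn_ord z); rewrite zk ltnNge Nk.
Qed.

(** Nonnegativity of the diagonal is the only issue: at most the two neighbours
    of [x] receive mass, each at most one half. *)
Lemma stochastic_mh beta delta : 0 <= beta -> stochastic (@mh_kernel R n beta delta).
Proof.
move=> b0 x; split=> [y|].
  rewrite mxE; case: eqP => _; last exact: mh_move_ge0.
  rewrite subr_ge0.
  apply: le_trans (_ : \sum_(z : state n) 2^-1 * ((z == x.+1 :> nat)%:R + (z == x.-1 :> nat)%:R) <= _).
    rewrite [leRHS](bigID (fun z => z != x))/= -[leLHS]addr0 lerD//; last first.
      by apply: sumr_ge0 => z _; rewrite mulr_ge0// addr_ge0.
    apply: ler_sum => z zx; apply: le_trans (mh_move_le _ _ _ _ b0) _.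
    rewrite proposalE; last by rewrite eq_sym.
    case: ifP => [/orP[]/eqP ->|_].
    - rewrite /= eqxx ler_peMr// lerDr//.
    - rewrite /= eqxx ler_peMr// lerDl//.
    - by rewrite mulr_ge0// addr_ge0.
  rewrite -mulr_sumr big_split /=.
  have := sum_ord_eq_le1 n.*2.+1 x.+1; have := sum_ord_eq_le1 n.*2.+1 x.-1.
  lra.
rewrite (bigD1 x)//= mxE eqxx.
under [X in _ + X]eq_bigr => z zx do rewrite mxE eq_sym (negPf zx).
by rewrite subrK.
Qed.

Lemma reversible_mh beta delta :
  reversible (@gibbs R n beta delta) (mh_kernel beta delta).
Proof.
move=> x y; rewrite !mxE (eq_sym y x); case: eqVneq => [->//|xy].
have psym : @proposal R n x y = proposal y x.
  by rewrite !proposalE 1?(eq_sym y x)// orbC.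
rewrite /mh_move /gibbs psym; set Z := \sum_z _.
have e : expR (- beta * energy delta x) *
      expR (- beta * Num.max (energy delta y - energy delta x) 0) =
    expR (- beta * energy delta y) *
      expR (- beta * Num.max (energy delta x - energy delta y) 0).
  rewrite -!expRD -!mulrDr !addr_maxr !addr0 maxC.
  congr (expR (_ * _)); congr Num.max; ring.
have swap (a b c d : R) : a / b * (c * d) = c / b * (a * d) by ring.
by rewrite [LHS]swap [RHS]swap e.
Qed.

Lemma flipK x : flip (flip x) = x.
Proof. exact: rev_ordK. Qed.

Lemma stochastic_orbit (pi : state n -> R) : (forall x, 0 < pi x) ->
  stochastic (orbit_kernel pi).
Proof.
move=> pi0 x; split=> [y|].
  by rewrite mxE divr_ge0 ?addr_ge0 ?mulr_ge0 ?ler0n ?ltW.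
have := orbit_kernelE pi ones x; rewrite !mxE !mulr1 divff ?gt_eqF ?addr_gt0//.
by move=> <-; apply: eq_bigr => y _; rewrite [ones _ _]mxE mulr1.
Qed.

Lemma reversible_orbit (pi : state n -> R) : reversible pi (orbit_kernel pi).
Proof.
move=> x y; rewrite !mxE (eq_sym y x).
have -> : (y == flip x) = (x == flip y) by apply/eqP/eqP => ->; rewrite flipK.
case: eqVneq => [->//|_]; case: eqP => [->|_]; last by rewrite !mulr0 !addr0 !mul0r !mulr0.
by rewrite flipK [pi y + pi _]addrC /= !mulr0 !add0r !mulr1; exact: mulrCA.
Qed.

(** * Spectral gap of the averaged chain *)

(** The state of coordinate [k]; the default value of [inord] is taken only for
    [k > n]. *)
Definition site (k : nat) : state n := inord (n + k).

Lemma val_site k : (k <= n)%N -> site k = (n + k)%N :> nat.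
Proof. by move=> kn; rewrite inordK// ltnS -addnn leq_add2l. Qed.

(** The density increases with the distance to [- delta], and among the states
    of modulus at most [j] the farthest one is [j] itself, because [delta > 0]. *)
Lemma gibbs_site_max beta delta j x : 0 <= beta -> 0 < delta < 2^-1 -> (j <= n)%N ->
  (`|Defs.coord x| <= j)%N -> gibbs beta delta x <= gibbs beta delta (site j).
Proof.
move=> b0 /andP[d0 d1] jn xj; rewrite -[leRHS]mul1r -expR0; apply: gibbs_le.
rewrite mulr_ge0_le0// (energy_ge _ (site j)) ?val_site ?leq_addr// natrD.
have [nx|xn] := leqP n x.
  rewrite energy_ge//.
  have : (x%:R <= n%:R + j%:R :> R) by rewrite -natrD ler_nat; move: xj; rewrite /Defs.coord; lia.
  lra.
rewrite energy_lt//.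
have : (n%:R <= x%:R + j%:R :> R) by rewrite -natrD ler_nat; move: xj; rewrite /Defs.coord; lia.
lra.
Qed.

Lemma mh_kernel_site beta delta j : 0 < delta -> (j < n)%N ->
  @mh_kernel R n beta delta (site j) (site j.+1) = 2^-1.
Proof.
move=> d0 jn; have jn' := ltnW jn.
have ne : site j != site j.+1.
  by rewrite -val_eqE /= !val_site// addnS neq_ltn leqnn.
rewrite mxE (negPf ne) /mh_move proposalE// !val_site// addnS eqxx orbT.
rewrite !energy_ge ?val_site ?leq_addr//.
rewrite max_r ?mulr0 ?expR0 ?mulr1// subr_le0 lerN2 !lerD2r ler_nat; lia.
Qed.

Lemma even_site (h : 'cV[R]_n.*2.+1) x : (forall x, h (flip x) 0 = h x 0) ->
  h x 0 = h (site `|Defs.coord x|%N) 0.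
Proof.
move=> hev; have [nx|xn] := leqP n x.
  congr (h _ _); apply: val_inj => /=.
  by rewrite val_site /Defs.coord; have := ltn_ord x; lia.
rewrite -hev; congr (h _ _); apply: val_inj => /=.
by rewrite val_site /Defs.coord; have := ltn_ord x; lia.
Qed.

(** Cauchy-Schwarz along the path from [k] to [n]. *)
Lemma sq_path_le (H : nat -> R) k : (k <= n)%N ->
  (H n - H k) ^+ 2 <=
    n%:R * \sum_(j < n) (k <= j)%N%:R * (H j.+1 - H j) ^+ 2.
Proof.
move=> kn; rewrite -telescope_sumr// big_geq_mkord big_mkcond /=.
have := @cauchy_schwarz R 'I_n (fun j => (k <= j)%N%:R)
  (fun j : 'I_n => H j.+1 - H j) (fun=> 1) (fun=> ler0n _ _).
rewrite (eq_bigr (fun j : 'I_n => if (k <= j)%N then H j.+1 - H j else 0)); last first.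
  by move=> j _; rewrite mulr1 mulrC mulr_natr mulrb.
move=> h; apply: le_trans h _; rewrite mulrC ler_wpM2r//.
  by apply: sumr_ge0 => j _; rewrite mulr_ge0 ?sqr_ge0.
apply: le_trans (_ : \sum_(j < n) 1 <= _); last by rewrite sumr_const card_ord.
by apply: ler_sum => j _; rewrite expr1n mulr1 lern1 leq_b1.
Qed.

Lemma sum_site_le (F : state n -> R) : (forall x, 0 <= F x) ->
  \sum_(j < n) F (site j) <= \sum_x F x.
Proof.
move=> F0; pose G i := F (inord i).
have -> : \sum_x F x = \sum_(0 <= i < n.*2.+1) G i.
  by rewrite big_mkord; apply: eq_bigr => x _; rewrite /G inord_val.
have -> : \sum_(j < n) F (site j) = \sum_(n <= i < n + n) G i.
  rewrite -[n in RHS]add0n big_addn add0n addnK big_mkord.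
  by apply: eq_bigr => j _; rewrite /G /site addnC.
have leD : (n + n <= n.*2.+1)%N by rewrite addnn.
rewrite [leRHS](@big_cat_nat _ _ _ (n + n))//=.
rewrite (@big_cat_nat _ _ _ n 0 (n + n))//= ?leq_addr//.
by rewrite ler_wpDr ?ler_wpDl//; apply: sumr_ge0 => i _; exact: F0.
Qed.

(** Keep, in the Dirichlet form, only the edges of the nonnegative half. They all
    point uphill, so the proposal is accepted with probability one. *)
Lemma dirichlet_site beta delta (h : 'cV[R]_n.*2.+1) :
  0 <= beta -> 0 < delta ->
  \sum_(j < n) @gibbs R n beta delta (site j) * (h (site j.+1) 0 - h (site j) 0) ^+ 2
   <= 4 * (ip (@gibbs R n beta delta) h h -
             ip (@gibbs R n beta delta) h (@mh_kernel R n beta delta *m h)).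
Proof.
move=> b0 d0; set pi := @gibbs R n beta delta; set P := @mh_kernel R n beta delta.
have sP : stochastic P by exact: stochastic_mh.
have pi0 x : 0 <= pi x by rewrite ltW// gibbs_gt0.
rewrite dirichletE//; last exact: reversible_mh.
have F0 x y : 0 <= pi x * P x y * (h x 0 - h y 0) ^+ 2.
  exact: mulr_ge0 (mulr_ge0 (pi0 x) ((sP x).1 y)) (sqr_ge0 _).
have : \sum_(j < n) 2^-1 * (pi (site j) * (h (site j.+1) 0 - h (site j) 0) ^+ 2)
   <= \sum_x \sum_y pi x * P x y * (h x 0 - h y 0) ^+ 2.
  apply: (@le_trans _ _ (\sum_(j < n) \sum_y pi (site j) * P (site j) y *
     (h (site j) 0 - h y 0) ^+ 2)); last first.
    apply: (sum_site_le (fun x => \sum_y pi x * P x y * (h x 0 - h y 0) ^+ 2)) => x.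
    exact: sumr_ge0.
  apply: ler_sum => j _; rewrite (bigD1 (site j.+1))//=.
  rewrite {1}/P mh_kernel_site// -[leLHS]addr0; apply: lerD.
    by rewrite le_eqVlt; apply/orP; left; apply/eqP; ring.
  exact: sumr_ge0.
rewrite -mulr_sumr; lra.
Qed.

(** An even function is determined by its values on [{0, ..., n}], and every
    [x], folded to [`|x|], is joined to the mode [n] inside this half by a path
    along which the density is never below its value at [x]. The valley at the origin is thus
    never crossed, and the constant depends on neither [beta] nor [delta]:
    [12 n^2] bounds [4] (from [dirichlet_site]) times the path length [n] times
    the number [2 n + 1 <= 3 n] of states. *)
Lemma poincare_even beta delta (h : 'cV[R]_n.*2.+1) :
  (0 < n)%N -> 0 <= beta -> 0 < delta < 2^-1 -> (forall x, h (flip x) 0 = h x 0) ->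
  ip (@gibbs R n beta delta) ones h = 0 ->
  ip (@gibbs R n beta delta) h h <= 12 * n%:R ^+ 2 *
    (ip (@gibbs R n beta delta) h h -
       ip (@gibbs R n beta delta) h (@mh_kernel R n beta delta *m h)).
Proof.
move=> n0 b0 hd hev h0; set pi := @gibbs R n beta delta.
apply: le_trans (variance_le _ _ (h (site n) 0) (prob_gibbs _ _) h0) _.
have -> : ip pi (h - h (site n) 0 *: ones) (h - h (site n) 0 *: ones) =
    \sum_x pi x * (h (site n) 0 - h (site `|Defs.coord x|%N) 0) ^+ 2.
  by apply: eq_bigr => x _; rewrite !mxE mulr1 (even_site _ x)//; ring.
pose D (j : nat) := (h (site j.+1) 0 - h (site j) 0) ^+ 2.
have D0 j : 0 <= D j by exact: sqr_ge0.
apply: (@le_trans _ _ (\sum_x \sum_(j < n)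
    n%:R * (pi (site j) * D j))).
  apply: ler_sum => x _.
  have xn : (`|Defs.coord x| <= n)%N by rewrite /Defs.coord; have := ltn_ord x; lia.
  apply: le_trans (ler_wpM2l (ltW (gibbs_gt0 beta delta x))
    (sq_path_le (fun k => h (site k) 0) _ xn)) _.
  rewrite mulr_sumr mulr_sumr; apply: ler_sum => j _.
  rewrite mulrCA ler_wpM2l// mulrA ler_wpM2r ?sqr_ge0//.
  have [xj|_] := leqP `|Defs.coord x|%N j; last by rewrite /= mulr0 ltW// gibbs_gt0.
  by rewrite mulr1 gibbs_site_max// ltnW.
rewrite sumr_const card_ord -mulr_sumr.
set A := \sum_(j < n) _; set E := _ - _.
have hA : A <= 4 * E by exact: dirichlet_site (proj1 (andP hd)).
have A0 : 0 <= A by apply: sumr_ge0 => j _; rewrite mulr_ge0// ltW// gibbs_gt0.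
have n1 : 1 <= n%:R :> R by rewrite ler1n.
rewrite -(mulr_natl _ n.*2.+1) -natr1 -mul2n natrM.
have : (2 * n%:R + 1) * (n%:R * A) <= 3 * n%:R * (n%:R * A).
  by rewrite ler_wpM2r ?mulr_ge0//; lra.
have : n%:R ^+ 2 * A <= n%:R ^+ 2 * (4 * E) by rewrite ler_wpM2l// sqr_ge0.
rewrite expr2; lra.
Qed.

(** [Q] is the orthogonal projection onto even functions, so the quadratic form
    of [Q P Q] at [f] is that of [P] at the even function [Q f]. *)
Lemma rayleigh_double_average_le beta delta (f : 'cV[R]_n.*2.+1) :
  (0 < n)%N -> 0 <= beta -> 0 < delta < 2^-1 ->
  ip (@gibbs R n beta delta) ones f = 0 ->
  ip (@gibbs R n beta delta) f
     (double_average (@gibbs R n beta delta) (@mh_kernel R n beta delta) *m f) <=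
  (1 - (12 * n%:R ^+ 2)^-1) * ip (@gibbs R n beta delta) f f.
Proof.
move=> n0 b0 hd f0; rewrite /double_average; set pi := @gibbs R n beta delta.
set Q := orbit_kernel pi; set P := @mh_kernel R n beta delta.
have pi0 x : 0 < pi x by exact: gibbs_gt0.
have ppi : prob pi by exact: prob_gibbs.
have sQ : stochastic Q by exact: stochastic_orbit.
have rQ : reversible pi Q by exact: reversible_orbit.
rewrite -2!mulmxA reversible_ip//.
have hev x : (Q *m f) (flip x) 0 = (Q *m f) x 0.
  by rewrite !orbit_kernelE flipK addrC [pi _ + _]addrC.
have := poincare_even beta delta (Q *m f) n0 b0 hd hev.
rewrite -/pi -/P stationary// => /(_ f0).
have := contraction pi Q f ppi sQ rQ.
set a := ip pi f f; set b := ip _ _ _; set c := ip _ _ _ => ba bc.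
have n1 : 1 <= n%:R :> R by rewrite ler1n.
have n2 : 1 <= n%:R ^+ 2 :> R by rewrite exprn_ege1.
set N := 12 * _ in bc *.
have N1 : 1 <= N by rewrite /N; lra.
have N0 : 0 < N by lra.
have : N^-1 * b <= b - c by rewrite ler_pdivrMl.
have : (1 - N^-1) * b <= (1 - N^-1) * a.
  by rewrite ler_wpM2l// subr_ge0 invf_le1.
lra.
Qed.

(** The gap of [Q P Q] is at least [1 / (12 n^2)]; [lazy_norm_decay] then
    has the rate [a = 1 / (24 n^2)], and [1 - a <= expR (- a)]. *)
Lemma lazy_average_l1_le beta delta t x :
  (0 < n)%N -> 0 <= beta -> 0 < delta < 2^-1 ->
  @gibbs R n beta delta x *
    (\sum_y `|(@lazy_average R n beta delta ^+ t) x y - @gibbs R n beta delta y|) ^+ 2 <=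
  expR (- t%:R / (24 * n%:R ^+ 2)).
Proof.
move=> n0 b0 hd; set pi := @gibbs R n beta delta; set P := @mh_kernel R n beta delta.
have pi0 z : 0 < pi z by exact: gibbs_gt0.
have ppi : prob pi by exact: prob_gibbs.
have sQ : stochastic (orbit_kernel pi) by exact: stochastic_orbit.
have rQ : reversible pi (orbit_kernel pi) by exact: reversible_orbit.
have sK : stochastic (double_average pi P).
  by apply: stochasticM => //; apply: stochasticM => //; exact: stochastic_mh.
have rK : reversible pi (double_average pi P).
  exact: reversible_sandwich (reversible_mh _ _).
have n1 : 1 <= n%:R :> R by rewrite ler1n.
have n2 : 1 <= n%:R ^+ 2 :> R by rewrite exprn_ege1.
have g1 : (12 * n%:R ^+ 2)^-1 <= 1 :> R by rewrite invf_le1; lra.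
have r0 : 0 <= 1 - (12 * n%:R ^+ 2)^-1 / 2 :> R by lra.
apply: (@le_trans _ _ ((1 - (12 * n%:R ^+ 2)^-1 / 2) ^+ t)).
  apply: l1_le_norm => //.
  - exact: stochastic_lazy.
  - exact: reversible_lazy.
  - exact: exprn_ge0.
  move=> f f0; apply: lazy_norm_decay => // g g0.
  exact: rayleigh_double_average_le.
have -> : - t%:R / (24 * n%:R ^+ 2) = t%:R * (- ((12 * n%:R ^+ 2)^-1 / 2)) :> R.
  by field; rewrite gt_eqF//; lra.
by rewrite expRM_natl lerXn2r ?nnegrE ?expR_ge0// expR_ge1Dx.
Qed.

(** * A slow test function for the Metropolis-Hastings chain *)

Lemma natr_card_state : n.*2.+1%:R = 2 * n%:R + 1 :> R.
Proof. by rewrite -natr1 -mul2n natrM. Qed.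

Lemma energy_bounds delta x : 0 < delta < 2^-1 ->
  - (n%:R + delta) <= energy delta x <= - delta.
Proof.
move=> /andP[d0 d1]; have [nx|xn] := leqP n x.
  rewrite energy_ge//; have : n%:R <= x%:R :> R by rewrite ler_nat.
  have : x%:R <= n%:R + n%:R :> R.
    by rewrite -natrD ler_nat addnn -ltnS ltn_ord.
  lra.
rewrite energy_lt//.
have : x%:R + 1 <= n%:R :> R by rewrite natr1 ler_nat.
have : 0 <= x%:R :> R by [].
lra.
Qed.

Lemma gibbs_lower beta delta x : 0 <= beta -> 0 < delta < 2^-1 ->
  1 <= (2 * n%:R + 1) * expR (beta * n%:R) * gibbs beta delta x.
Proof.
move=> b0 hd; rewrite -[leLHS](proj2 (prob_gibbs beta delta)).
apply: (@le_trans _ _ (\sum_(y : state n) expR (beta * n%:R) * gibbs beta delta x)).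
  apply: ler_sum => y _; apply: gibbs_le; rewrite ler_wpM2l//.
  have := energy_bounds _ x hd; have := energy_bounds _ y hd; lra.
by rewrite sumr_const card_ord -(mulr_natl _ n.*2.+1) natr_card_state mulrA.
Qed.

Lemma gibbs_max_lower beta delta : 0 <= beta -> 0 < delta < 2^-1 ->
  1 <= (2 * n%:R + 1) * @gibbs R n beta delta ord_max.
Proof.
move=> b0 hd; rewrite -[leLHS](proj2 (prob_gibbs beta delta)).
apply: (@le_trans _ _ (\sum_(y : state n) @gibbs R n beta delta ord_max)).
  apply: ler_sum => y _; rewrite -[leRHS]mul1r -expR0; apply: gibbs_le.
  have := energy_bounds _ y hd.
  rewrite (energy_ge _ ord_max) ?(andP hd).1//= -?addnn ?leq_addr// natrD => h.
  by rewrite mulr_ge0_le0//; lra.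
by rewrite sumr_const card_ord -(mulr_natl _ n.*2.+1) natr_card_state.
Qed.

Lemma mh_kernel_le_half beta delta x y : 0 <= beta -> x != y ->
  mh_kernel beta delta x y <= 2^-1.
Proof.
move=> b0 xy; rewrite mxE (negPf xy); apply: le_trans (mh_move_le _ _ _ _ b0) _.
by rewrite mxE; case: ifP.
Qed.

Lemma mh_kernel_eq0 beta delta x y :
  x != y -> (x != y.+1 :> nat) -> (y != x.+1 :> nat) ->
  mh_kernel beta delta x y = 0.
Proof.
move=> xy h1 h2; rewrite mxE (negPf xy) /mh_move proposalE//.
by rewrite (negPf h1) (negPf h2) mul0r.
Qed.

Definition left_half : 'cV[R]_n.*2.+1 := \col_x (x < n)%N%:R.

(** The indicator of the left half changes only across the edge [{-1, 0}], so its
    Dirichlet form is the equilibrium flow through that edge; the proposal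
    probability [1 / 2] bounds this flow by half of the mass of the state [0]. *)
Lemma dirichlet_left_half beta delta : (0 < n)%N -> 0 <= beta ->
  ip (@gibbs R n beta delta) left_half left_half -
    ip (@gibbs R n beta delta) left_half (mh_kernel beta delta *m left_half) <=
  2^-1 * @gibbs R n beta delta (site 0).
Proof.
move=> n0 b0; set pi := @gibbs R n beta delta; set P := @mh_kernel R n beta delta.
have rP : reversible pi P := reversible_mh _ _.
have sP : stochastic P := stochastic_mh _ _ b0.
have pi0 x : 0 < pi x by exact: gibbs_gt0.
rewrite dirichletE// ler_pM2l ?invr_gt0//.
pose a : state n := inord n.-1; pose b : state n := site 0.
have va : a = n.-1 :> nat by rewrite inordK//; lia.
have vb : b = n :> nat by rewrite val_site// addn0.
have ab : a != b by rewrite -val_eqE /= va vb; lia.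
apply: (@le_trans _ _ (\sum_x \sum_y 2^-1 * pi b *
   ((x == a)%:R * (y == b)%:R + (x == b)%:R * (y == a)%:R))); last first.
  (* Each ordered pair in the edge occurs once, so the total is [pi b]. *)
  have sum1 (c : state n) : \sum_x (x == c)%:R = 1 :> R.
    by rewrite (bigD1 c)//= eqxx big1 ?addr0// => x /negPf ->.
  under eq_bigr => x _ do
    rewrite -mulr_sumr big_split /= -!mulr_sumr !sum1 !mulr1.
  by rewrite -mulr_sumr big_split /= !sum1; lra.
apply: ler_sum => x _; apply: ler_sum => y _.
rewrite [left_half x 0]mxE [left_half y 0]mxE.
have c0 (u v : bool) (w : bool) (z : bool) :
    0 <= 2^-1 * pi b * (u%:R * v%:R + w%:R * z%:R) :> R.
  apply: mulr_ge0; last by rewrite addr_ge0 ?mulr_ge0.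
  by apply: mulr_ge0; [rewrite invr_ge0 | exact: ltW].
have [->|xy] := eqVneq x y; first by rewrite subrr expr0n mulr0.
have [xyS|xyS] := eqVneq (x : nat) y.+1.
  have [xn|xn] := ltnP x n.
    by rewrite (_ : (y < n)%N) ?subrr ?expr0n ?mulr0//; lia.
  have [yn|yn] := ltnP y n; last by rewrite subrr expr0n mulr0.
  have -> : x = b by apply: val_inj; rewrite /= vb; lia.
  have -> : y = a by apply: val_inj; rewrite /= va; lia.
  rewrite !eqxx (eq_sym b) (negPf ab) /= sub0r sqrrN expr1n !mulr1 mul0r add0r mulr1.
  by rewrite mulrC ler_pM2r// /P mh_kernel_le_half// eq_sym.
have [yxS|yxS] := eqVneq (y : nat) x.+1; last first.
  by rewrite /P mh_kernel_eq0// mulr0 mul0r.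
have [yn|yn] := ltnP y n.
  by rewrite (_ : (x < n)%N) ?subrr ?expr0n ?mulr0//; lia.
have [xn|xn] := ltnP x n; last by rewrite subrr expr0n mulr0.
have -> : x = a by apply: val_inj; rewrite /= va; lia.
have -> : y = b by apply: val_inj; rewrite /= vb; lia.
rewrite !eqxx (negPf ab) /= subr0 expr1n !mulr1 mul0r addr0 mulr1 rP.
by rewrite mulrC ler_pM2r// /P mh_kernel_le_half// eq_sym.
Qed.

(** The centred indicator of the left half. Its variance is the product of the
    masses of the two halves, and these are bounded below by the masses of the two
    end points; the mass of [0] is smaller than that of [-n] by the factor
    [expR (- (beta * (n - 2 * delta)))]. *)
Lemma rayleigh_mh_ge beta delta : (0 < n)%N -> 0 <= beta -> 0 < delta < 2^-1 ->
  exists f : 'cV[R]_n.*2.+1,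
  [/\ ip (@gibbs R n beta delta) ones f = 0,
      0 < ip (@gibbs R n beta delta) f f &
      (1 - (2 * n%:R + 1) ^+ 2 / expR (beta * (n%:R - 2 * delta))) *
        ip (@gibbs R n beta delta) f f <=
      ip (@gibbs R n beta delta) f (mh_kernel beta delta *m f)].
Proof.
move=> n0 b0 hd; set pi := @gibbs R n beta delta; set P := @mh_kernel R n beta delta.
have ppi : prob pi := prob_gibbs _ _.
have rP : reversible pi P := reversible_mh _ _.
have sP : stochastic P := stochastic_mh _ _ b0.
have pi0 x : 0 < pi x by exact: gibbs_gt0.
pose c := ip pi ones left_half; exists (left_half - c *: ones).
have dE : ip pi left_half left_half - ip pi left_half (P *m left_half) =
    ip pi (left_half - c *: ones) (left_half - c *: ones) -
    ip pi (left_half - c *: ones) (P *m (left_half - c *: ones)).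
  rewrite !dirichletE//; congr (_ * _); apply: eq_bigr => x _; apply: eq_bigr => y _.
  by rewrite !mxE; ring.
have ff : ip pi (left_half - c *: ones) (left_half - c *: ones) = c * (1 - c).
  rewrite ip_centered// -/c mulrBr mulr1 -expr2; congr (_ - _).
  apply: eq_bigr => x _; rewrite !mxE mulr1.
  by case: ltnP => _; rewrite /= ?mulr1 ?mulr0.
have c_ge : pi ord0 <= c.
  rewrite /c /ip (bigD1 ord0)//= !mxE /= n0 !mulr1 lerDl.
  by apply: sumr_ge0 => x _; rewrite !mxE mulr1 mulr_ge0// ltW.
have c_le : pi ord_max <= 1 - c.
  rewrite -(proj2 ppi) -sumrB (bigD1 ord_max)//= !mxE /=.
  rewrite (_ : (n.*2 < n)%N = false); last by lia.
  rewrite mulr0 subr0 lerDl; apply: sumr_ge0 => x _; rewrite !mxE mulr1.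
  by case: ltnP => _; rewrite /= ?mulr1 ?mulr0 ?subrr ?subr0// ltW.
have c0 : 0 < c := lt_le_trans (pi0 _) c_ge.
have c1 : 0 < 1 - c := lt_le_trans (pi0 _) c_le.
split; [exact: centered_mean0 | by rewrite ff mulr_gt0 |].
set f := left_half - _ in dE ff *; set g := _ / _.
suff : ip pi f f - ip pi f (P *m f) <= g * ip pi f f by lra.
rewrite -dE; apply: le_trans (dirichlet_left_half _ _ n0 b0) _; rewrite -/pi ff.
have h0 : pi (site 0) <= expR (- (beta * (n%:R - 2 * delta))) * pi ord0.
  apply: gibbs_le; have [d0 d1] := andP hd.
  rewrite energy_lt// energy_ge ?val_site//= ?addn0//.
  by rewrite le_eqVlt; apply/orP; left; apply/eqP; ring.
have N1 : 1 <= 2 * n%:R + 1 :> R by rewrite lerDr.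
(* One factor [2 n + 1] compensates [pi ord_max], the other one is spare. *)
have hm := gibbs_max_lower beta delta b0 hd.
rewrite -/pi in hm; rewrite expRN in h0.
set e := expR _ in g h0 *; set N := 2 * n%:R + 1 in g hm N1 *.
have e0 : 0 < e := expR_gt0 _.
have ei0 : 0 < e^-1 by rewrite invr_gt0.
apply: (@le_trans _ _ (e^-1 * pi ord0 * (N ^+ 2 * pi ord_max))).
  have N2 : 1 <= N ^+ 2 * pi ord_max.
    by rewrite expr2 -mulrA -[leLHS]mulr1 ler_pM.
  apply: (@le_trans _ _ (e^-1 * pi ord0 * 1)); last first.
    by rewrite ler_wpM2l// mulr_ge0// ltW.
  by have := pi0 (site 0); lra.
have -> : g * (c * (1 - c)) = e^-1 * c * (N ^+ 2 * (1 - c)) by rewrite /g; ring.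
have Nge : 0 <= N ^+ 2 by exact: sqr_ge0.
apply: ler_pM.
- by apply: mulr_ge0; exact: ltW.
- by apply: mulr_ge0 => //; exact: ltW.
- by rewrite ler_wpM2l// ltW.
- by rewrite ler_wpM2l.
Qed.

(** * Mixing times *)

(** If [lam = 1 - g] satisfies [lam ^+ t <= eps], then
    [t * (1 / lam - 1) >= t * ln (1 / lam) >= ln (1 / eps)], and
    [1 / lam - 1] is the inverse of [1 / g - 1]. When [eps > 1] or the prefactor
    is negative the bound is at most [ln 2 < 1 <= t]. *)
Lemma mh_time_ge beta delta eps (t : nat) :
  (0 < n)%N -> 0 <= beta -> 0 < delta < 2^-1 -> 0 < eps <= 2 -> (0 < t)%N ->
  d1 (@gibbs R n beta delta) (mh_kernel beta delta) t <= eps ->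
  (expR (beta * (n%:R - 2 * delta)) / (2 * n%:R + 1) ^+ 2 - 1) * ln (1 / eps) <= t%:R.
Proof.
move=> n0 b0 hd /andP[eps0 eps2] t0 hd1.
have t1 : 1 <= t%:R :> R by rewrite ler1n.
rewrite div1r lnV ?posrE//.
have [f [f0 ff hgap]] := rayleigh_mh_ge beta delta n0 b0 hd.
set e := expR _ in hgap *; set N := (2 * n%:R + 1) ^+ 2 in hgap *.
have e0 : 0 < e := expR_gt0 _.
have N0 : 0 < N by rewrite exprn_gt0// ltr_wpDl.
set A := e / N - 1.
have A1 : -1 <= A by rewrite /A lerDr ltW// divr_gt0.
have leps := ln_le_sub1 _ _ eps0.
have [l0|l0] := leP 0 (ln eps).
  have : 0 <= (A + 1) * ln eps by rewrite mulr_ge0//; lra.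
  lra.
have [A0|A0] := leP A 0.
  apply: le_trans (_ : 0 <= _); last by lra.
  by rewrite mulr_le0_ge0//; lra.
have lamE : 1 - N / e = A / (A + 1).
  have -> : A + 1 = e / N by rewrite /A subrK.
  by rewrite /A; field; rewrite !gt_eqF.
rewrite lamE in hgap.
have lam0 : 0 < A / (A + 1) by rewrite divr_gt0//; lra.
have rows x : \sum_y `|(mh_kernel beta delta ^+ t) x y - @gibbs R n beta delta y| <= eps.
  by apply: le_trans hd1; rewrite /d1; exact: le_bigmax.
have := rayleigh_exp_le _ _ _ _ f _ _ t (prob_gibbs _ _) (stochastic_mh _ _ b0)
  (reversible_mh _ _) f0 ff lam0 eps0 hgap rows.
rewrite -ler_ln ?posrE ?exprn_gt0// lnXn// -mulr_natl => hln.
have : - ln (A / (A + 1)) <= A^-1.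
  rewrite -lnV ?posrE//; apply: le_trans (ln_le_sub1 _ _ _) _; first by rewrite invr_gt0.
  by rewrite le_eqVlt; apply/orP; left; apply/eqP; field; rewrite !gt_eqF//; lra.
move=> h; rewrite mulrC -ler_pdivlMr//.
have : t%:R * - ln (A / (A + 1)) <= t%:R * A^-1 by rewrite ler_wpM2l.
lra.
Qed.

(** The norm bound is converted to a bound at each state [x] at the price of
    [1 / gibbs x <= (2 n + 1) expR (beta n)]. *)
Lemma lazy_average_d1_le beta delta eps (t : nat) :
  (0 < n)%N -> 0 <= beta -> 0 < delta < 2^-1 -> 0 < eps ->
  48 * n%:R ^+ 2 * (beta * n%:R + ln ((2 * n%:R + 1) / eps)) <= t%:R ->
  d1 (@gibbs R n beta delta) (lazy_average beta delta) t <= eps.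
Proof.
move=> n0 b0 hd eps0 ht; apply/bigmax_leP; split=> [|x _]; first exact: ltW.
have := lazy_average_l1_le beta delta t x n0 b0 hd.
have := gibbs_lower beta delta x b0 hd.
set r := \sum_y _; set p := gibbs _ _ _; set N := 2 * n%:R + 1 in ht *.
have r0 : 0 <= r by apply: sumr_ge0.
have N1 : 1 <= N by rewrite lerDr.
have N0 : 0 < N by apply: lt_le_trans N1.
have n2 : 0 < 24 * n%:R ^+ 2 :> R by rewrite mulr_gt0// exprn_gt0// ltr0n.
set b := beta * n%:R in ht *; set S := b + _ in ht.
have b_ge0 : 0 <= b by rewrite mulr_ge0.
move=> Np hr; rewrite -(@ler_pXn2r _ 2)// ?nnegrE ?(ltW eps0)//.
have hexp : expR (- t%:R / (24 * n%:R ^+ 2)) <= expR (- b) ^+ 2 * (eps / N) ^+ 2.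
  have -> : expR (- b) ^+ 2 * (eps / N) ^+ 2 = expR (- (2 * S)).
    have -> : eps / N = expR (- ln (N / eps)).
      by rewrite expRN lnK ?posrE ?divr_gt0// invf_div.
    by rewrite -exprMn -expRD -expRM_natl; congr expR; rewrite /S; ring.
  by rewrite ler_expR mulNr lerN2 ler_pdivlMr//; apply: le_trans ht; lra.
have eb1 : expR (- b) <= 1 by rewrite -[leRHS]expR0 ler_expR oppr_le0.
have eb0 : 0 < expR (- b) := expR_gt0 _.
have ebN : expR b * expR (- b) = 1 by rewrite -expRD subrr expR0.
apply: (@le_trans _ _ (N * expR b * (p * r ^+ 2))).
  by rewrite mulrA ler_peMl// sqr_ge0.
have Neb : 0 <= N * expR b by rewrite mulr_ge0 ?expR_ge0// ltW.
apply: le_trans (ler_wpM2l Neb (le_trans hr hexp)) _.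
have -> : N * expR b * (expR (- b) ^+ 2 * (eps / N) ^+ 2) =
   (expR b * expR (- b)) * expR (- b) * (N^-1 * eps ^+ 2).
  by field; rewrite gt_eqF.
rewrite ebN mul1r mulrA ler_piMl ?sqr_ge0//.
by apply: mulr_ile1; rewrite ?invf_le1 ?invr_ge0// ltW.
Qed.

(** The claimed bound exceeds the sufficient real time [48 n^2 S] by at least
    one, which leaves room for rounding up to an integer. The hypothesis
    [eps <= 2] enters here, through [S >= ln (3 / 2) >= 1 / 3]. *)
Lemma upper_bound_slack beta delta eps :
  (0 < n)%N -> 0 < beta -> 0 < delta < 2^-1 -> 0 < eps <= 2 ->
  let S := beta * n%:R + ln ((2 * n%:R + 1) / eps) in
  0 <= 48 * n%:R ^+ 2 * S /\
  48 * n%:R ^+ 2 * S + 1 <=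
  72 * n%:R ^+ 3 * expR (2 * beta * delta) / (1 - expR (- beta)) * S.
Proof.
move=> n0 b0 /andP[d0 _] /andP[eps0 eps2] S.
have n1 : 1 <= n%:R :> R by rewrite ler1n.
have X0 : 3 / 2 <= (2 * n%:R + 1) / eps by rewrite ler_pdivlMr//; nra.
have X1 : 0 < (2 * n%:R + 1) / eps by lra.
have S13 : 3^-1 <= S.
  have := ln_le_sub1 _ ((2 * n%:R + 1) / eps)^-1.
  rewrite invr_gt0 lnV ?posrE// => /(_ X1).
  have : ((2 * n%:R + 1) / eps)^-1 <= (3 / 2)^-1 by rewrite lef_pV2 ?posrE//.
  have : 0 <= beta * n%:R by rewrite mulr_ge0// ltW.
  rewrite /S; lra.
have S0 : 0 < S by lra.
have n2 : 1 <= n%:R ^+ 2 :> R by rewrite exprn_ege1.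
have nS : 3^-1 <= n%:R ^+ 2 * S by nra.
split; first by lra.
have E1 : expR (- beta) < 1 by rewrite -[ltRHS]expR0 ltr_expR oppr_lt0.
have E2 : 1 <= expR (2 * beta * delta).
  by rewrite -[leLHS]expR0 ler_expR !mulr_ge0// ltW.
have E0 := expR_gt0 (- beta).
apply: (@le_trans _ _ (72 * n%:R ^+ 2 * S)); first by lra.
rewrite ler_pM2r// ler_pdivlMr; last by lra.
have n3 : n%:R ^+ 2 <= n%:R ^+ 3 :> R by rewrite ler_weXn2l.
apply: (@le_trans _ _ (72 * n%:R ^+ 3 * 1)); last by rewrite ler_pM2l//; lra.
nra.
Qed.

End Model.

Theorem proposition7p5 (R : realType) (n : nat) (beta delta eps : R)
    (hn : (0 < n)%N) (hbeta : 0 <= beta) (hdelta : 0 < delta < 2^-1)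
    (heps : 0 < eps <= 2) :
  (tmix1 (@gibbs R n beta delta) (lazy_average beta delta) eps <=
     if (beta == 0)%R then +oo
     else ((72 * n%:R ^+ 3 * expR (2 * beta * delta) / (1 - expR (- beta)) *
             (beta * n%:R + ln ((2 * n%:R + 1) / eps)))%R)%:E)%E
  /\
  ((((expR (beta * (n%:R - 2 * delta)) / (2 * n%:R + 1) ^+ 2 - 1) *
       ln (1 / eps))%R)%:E
     <= tmix1 (@gibbs R n beta delta) (mh_kernel beta delta) eps)%E.
Proof.
split; last first.
  by apply: le_ereal_inf_tmp => _ [t [t0 ht] <-]; rewrite lee_fin mh_time_ge.
case: eqVneq => [_|beta_neq0]; first exact: leey.
have beta0 : 0 < beta by rewrite lt_def beta_neq0.
have [B0 hB] := upper_bound_slack _ _ _ hn beta0 hdelta heps.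
set B := 48 * _ * _ in B0 hB.
(* The successor of the integer part: positive, and at most [B + 1]. *)
pose t := (Num.truncn B).+1.
have tB : B <= t%:R by rewrite ltW// truncnS_gt.
have tle : t%:R <= B + 1 by rewrite -natr1 lerD2r truncn_le.
apply: (@le_trans _ _ t%:R%:E); last by rewrite lee_fin (le_trans tle).
apply: ereal_inf_lbound; exists t => //; split=> //.
by apply: lazy_average_d1_le => //; case/andP: heps.
Qed.
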